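(* Let $n = 2k$ with $k \ge 2$, and let $\mu(k)$ be the largest odd integer not exceeding $k$. Let $C = C(n,\{1,3,5,\ldots,\mu(k)\})$. Place the vertices of $C$ on a circle in a YSL-order and draw every edge as a straight chord. Then there is a coloring of the edges of $C$ with $\Delta(C)$ colors such that: (i) two edges of the same color neither share an endpoint nor cross; (ii) within each color class, all edges have the same jump-length. That is, for some single $s$, every edge $ij$ in the class satisfies $j \equiv i \pm s \pmod n$.
   Context: Circulants. For $n \ge 3$ and $S \subseteq \{1,2,\ldots,\lfloor n/2\rfloor\}$, the circulant $C(n,S)$ is the graph with vertex set $\{1,\ldots,n\}$. Its edge set is $\{ij : j \equiv i+s \pmod n \text{ for some } s \in S\}$. The elements of $S$ are called jump-lengths. $\Delta(G)$ denotes the maximum degree of $G$. YSL-order. Let $n = 2k$. Label the positions on a circle, in clockwise order, as $p_1, p_2, \ldots, p_{2k}$. A YSL-order places the odd vertices at the odd positions in their natural clockwise order, namely vertex $2i-1$ at position $p_{2i-1}$. It places the even vertices at the even positions so that, read clockwise, they appear in counterclockwise (decreasing cyclic) order. In other words, there is a fixed integer $m$ such that position $p_{2i}$ carries the even vertex congruent to $2m-2i \pmod{2k}$, for $i = 1,\ldots,k$. The value of $m$, that is, where vertex $2$ is placed, is arbitrary. For example, one YSL-order reads clockwise $\ldots, 2k-3, 4, 2k-1, 2, 1, 2k, 3, 2k-2, 5, \ldots$. Crossing and dispersability. Two chords cross if their four endpoints are distinct and interleave around the circle. A graph drawn with vertices on a circle and edges as chords is dispersable with respect to that vertex order if its edges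 can be colored with $\Delta(G)$ colors so that two edges of the same color neither share an endpoint nor cross. The color classes are called pages. *)

(* Defs.v *)
From mathcomp Require Import all_boot all_order all_fingroup all_algebra.

Set Implicit Arguments.
Unset Strict Implicit.
Unset Printing Implicit Defensive.

(* MathComp world.  A simple graph on a finType V is a symmetric irreflexive
   relation; an edge is the two-element set of its endpoints. *)

Section Graphs.

Variables (V : finType) (e : rel V).

Definition edges : {set {set V}} :=
  [set [set u.1; u.2] | u : V * V & e u.1 u.2].

Definition max_degree : nat := \max_(v : V) #|[set w | e v w]|.

End Graphs.

(* [order p] is the vertex at position [p]; the positions 0, ..., n - 1 are in
   clockwise order around the circle. *)

Section CircularDrawings.

Variables (n : nat) (order : {perm 'I_n}).

Definition position (v : 'I_n) : 'I_n := (order^-1)%g v.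

(* For two-element sets [a] and [b], the strict inequalities force x, y to be
   the two elements of [a] and z, t those of [b], all four distinct. *)
Definition cross (a b : {set 'I_n}) : bool :=
  [exists x in a, exists y in a, exists z in b, exists t in b,
     [&& position x < position z, position z < position y
       & position y < position t]
  || [&& position z < position x, position x < position t
       & position t < position y]].

Definition page_coloring (e : rel 'I_n) (K : Type) (c : {set 'I_n} -> K) :
    Prop :=
  forall a b, a \in edges e -> b \in edges e -> a != b -> c a = c b ->
    [disjoint a & b] /\ ~~ cross a b.

End CircularDrawings.

(* Vertices are residues modulo [n]: the vertex labelled i in {1, ..., n} is
   i %% n in 'I_n, so that 0 is the vertex labelled n.  Likewise the position
   p_n of a circular order is position 0. *)

(* j = i + s or j = i - s modulo n *)
Definition jump (n s : nat) : rel 'I_n :=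
  fun i j => (j == i + s %[mod n]) || (i == j + s %[mod n]).

(* Intended for n >= 3 and jump-lengths in {1, ..., n./2}. *)
Definition circulant (n : nat) (S : seq nat) : rel 'I_n :=
  fun i j => has (fun s => jump s i j) S.

Definition mu (k : nat) : nat := \max_(s < k.+1 | odd s) s.

Definition odd_jumps (k : nat) : seq nat := [seq s <- iota 1 (mu k) | odd s].

(* Since 2k is even, parity is well defined on residues. *)
Definition YSL_order (k : nat) (order : {perm 'I_(2 * k)}) : Prop :=
  exists m : int, forall p : 'I_(2 * k),
    if odd p then order p = p
    else (Posz (order p) = 2%:Z * m - Posz p %[mod Posz (2 * k)])%Z.

(* Main.v *)
Require Import Defs.
From mathcomp Require Import all_boot all_order all_fingroup all_algebra.
From mathcomp Require Import zify.

(** The graph is the complete bipartite graph between odd and even vertices.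
    In a YSL-order an odd vertex [a] sits at position [a] and an even vertex [b]
    at position [2m - b], so the positions of the ends of an edge [ab] add up to
    [2m + (a - b)] modulo [2k].  Hence the edges with a given odd difference
    [a - b] are parallel chords: they form a non-crossing matching, and they all
    have jump-length [min (a - b, 2k - (a - b))].  These [k] odd residues are the
    colors. *)

Set Implicit Arguments.
Unset Strict Implicit.
Unset Printing Implicit Defensive.

(** An odd number up to [k] is itself a candidate in the maximum defining [mu k], so the bound
    [mu k] can be traded for [k]. *)
Lemma mem_odd_jumps k s : (s \in odd_jumps k) = odd s && (s <= k).
Proof.
rewrite mem_filter mem_iota; case: (boolP (odd s)) => //= os.
have -> : 0 < s by case: s os.
rewrite add1n ltnS /= /mu; apply/idP/idP => [le_s_mu | le_sk].
  apply: leq_trans le_s_mu _; apply/bigmax_leqP => i _.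
  by rewrite -ltnS ltn_ord.
have lt_sk : s < k.+1 by [].
exact: (leq_bigmax_cond (Ordinal lt_sk)).
Qed.

Lemma odd_modd m k : odd (m %% (2 * k)) = odd m.
Proof. by rewrite odd_mod // oddM. Qed.

Lemma jump_sym n s (i j : 'I_n) : jump s i j = jump s j i.
Proof. by rewrite /jump orbC. Qed.

Lemma jump_odd k s (i j : 'I_(2 * k)) : odd s -> jump s i j -> odd i != odd j.
Proof.
move=> os /orP[] /eqP /(congr1 odd); rewrite !odd_modd oddD os => ->;
  by case: (odd _).
Qed.

(* Modulo [2k], the position of [v] in the YSL-order with [m = 0]. *)
Definition signed_label k (v : 'I_(2 * k)) : nat :=
  if odd v then v : nat else 2 * k - v.

(** For an edge with odd end [a] and even end [b] this is the residue of [a - b]. The sum over the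
    set makes it independent of the order of the ends. *)
Definition edge_class k (a : {set 'I_(2 * k)}) : nat :=
  (\sum_(v in a) signed_label v) %% (2 * k).

Lemma big_pair_sum (T : finType) (F : T -> nat) (x y : T) :
  x != y -> \sum_(v in [set x; y]) F v = F x + F y.
Proof. by move=> xy; rewrite big_setU1 ?inE // big_set1. Qed.

Lemma opp_parity_neq n (i j : 'I_n) : odd i != odd j -> i != j.
Proof. by apply: contraNneq => ->. Qed.

Lemma odd_signed_label k (v : 'I_(2 * k)) : odd (signed_label v) = odd v.
Proof.
rewrite /signed_label; case: ifP => // ov.
by rewrite oddB ?oddM ?ov // ltnW.
Qed.

Lemma edge_class_odd k (i j : 'I_(2 * k)) :
  odd i != odd j -> odd (edge_class [set i; j]).
Proof.
move=> oij; rewrite /edge_class odd_modd big_pair_sum ?opp_parity_neq //.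
by rewrite oddD !odd_signed_label; case: (odd i) (odd j) oij => [] [].
Qed.

Lemma edge_class_lt k (a : {set 'I_(2 * k)}) : 0 < k -> edge_class a < 2 * k.
Proof. by move=> k_gt0; rewrite ltn_mod muln_gt0. Qed.

(** The residues [d] and [2 * k - d] are opposite, so they give the same jump; the smaller one is at
    most [k]. *)
Definition class_jump k d := minn d (2 * k - d).

Lemma class_jump_mem k d :
  odd d -> d < 2 * k -> class_jump k d \in odd_jumps k.
Proof.
move=> od lt_d; rewrite mem_odd_jumps; apply/andP; split.
  by rewrite /class_jump /minn; case: ifP => //; rewrite oddB ?oddM ?od // ltnW.
by rewrite /class_jump; lia.
Qed.

Lemma jump_edge_class k (i j : 'I_(2 * k)) : odd i != odd j ->
  jump (class_jump k (edge_class [set i; j])) i j.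
Proof.
wlog oi : i j / odd i => [IH oij | oij].
  have [oi | noi] := boolP (odd i); first exact: IH.
  rewrite setUC jump_sym; apply: IH; last by rewrite eq_sym.
  by case: (odd i) (odd j) noi oij => [] [].
have k_gt0 : 0 < k by have := ltn_ord i; lia.
have := edge_class_lt [set i; j] k_gt0.
have nj : odd j = false by move: oij; rewrite oi; case: (odd j).
set d := edge_class _ => lt_d.
have di : j + d = i %[mod 2 * k].
  rewrite /d /edge_class big_pair_sum ?opp_parity_neq //.
  rewrite /signed_label oi nj modnDmr addnCA subnKC ?modnDr //.
  exact: ltnW.
(* If the minimum is [d], then [i] is [j + d]; otherwise [j] is [i + (2 * k - d)]. *)
rewrite /jump /class_jump /minn; case: ifP => _; first by rewrite di eqxx orbT.
apply/orP; left; apply/eqP.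
rewrite -[RHS]modnDml -di modnDml -addnA subnKC ?modnDr //.
exact: ltnW.
Qed.

Lemma circulant_odd_jumps k (i j : 'I_(2 * k)) :
  circulant (odd_jumps k) i j = (odd i != odd j).
Proof.
apply/hasP/idP => [[s] | oij].
  by rewrite mem_odd_jumps => /andP[os _]; apply: jump_odd.
exists (class_jump k (edge_class [set i; j])); last exact: jump_edge_class.
apply: class_jump_mem; first exact: edge_class_odd.
by apply: edge_class_lt; have := ltn_ord i; lia.
Qed.

(** Vertex [0] is adjacent to all [k] odd vertices. This provides a color for each of the [k] odd
    residues. *)
Lemma leq_max_degree k :
  0 < k -> k <= max_degree (@circulant (2 * k) (odd_jumps k)).
Proof.
move=> k_gt0.
have lt0 : 0 < 2 * k by rewrite muln_gt0.
have ltS (i : 'I_k) : i.*2.+1 < 2 * k by have := ltn_ord i; lia.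
apply: leq_trans (leq_bigmax (Ordinal lt0)).
pose f (i : 'I_k) := Ordinal (ltS i).
have f_inj : injective f.
  by move=> i j /(congr1 val) [] /double_inj /val_inj.
rewrite -[X in X <= _]card_ord -(card_image f_inj) subset_leq_card //.
apply/subsetP => _ /imageP[i _ ->].
by rewrite inE circulant_odd_jumps /= odd_double.
Qed.

(** The sums differ by [(t - x) - (y - z)], which lies strictly between [0] and [n]. *)
Lemma interleaved_sum_neq n x z y t :
  x < z -> z < y -> y < t -> t < n -> x + y <> z + t %[mod n].
Proof.
move=> xz zy yt tn /eqP.
have -> : z + t = x + y + ((z - x) + (t - y)) by lia.
rewrite -[X in X == _ %[mod _]]addn0 eqn_modDl mod0n modn_small; lia.
Qed.

Lemma YSL_position k (order : {perm 'I_(2 * k)}) : YSL_order order ->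
  exists r, forall v,
    position order v = signed_label v + ~~ odd v * r %[mod 2 * k].
Proof.
case=> m ysl.
have [k0 | k_gt0] := posnP k.
  by exists 0 => v; have := ltn_ord v; rewrite {2}k0.
have nz : Posz (2 * k) != 0%R by lia.
(* The shift [r] is the residue of [2m], taken as a natural number. *)
exists (absz (2%:Z * m %% Posz (2 * k))%Z) => v.
rewrite /signed_label; case: (boolP (odd v)) => [ov | nov].
  have := ysl v; rewrite ov mul0n addn0 => ov_fix.
  by rewrite /position -{1}ov_fix permK.
have := ysl (position order v); rewrite permKV.
(* An odd position carries an odd vertex, so the even [v] sits at an even position. *)
case: ifP => [op eq_v | _ eq_v]; first by rewrite eq_v op in nov.
have := eq_v; set p := position order v; move/eqP; rewrite eqz_mod_dvd.
case/dvdzP => q eq_q.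
have eq_r := divz_eq (2%:Z * m)%R (Posz (2 * k)).
have r_ge0 := modz_ge0 (2%:Z * m)%R nz.
apply/eqP; rewrite -eqz_nat -!modz_nat eqz_mod_dvd; apply/dvdzP.
(* The [- 1] absorbs the [2 * k] in [signed_label v]; the quotient accounts for reducing [2m] to
   [r]. *)
exists (q - 1 + ((2%:Z * m)%R %/ Posz (2 * k))%Z)%R.
rewrite mul1n PoszD gez0_abs // -subzn ?(ltnW (ltn_ord v)) //.
rewrite !GRing.mulrDl -eq_q; lia.
Qed.

Lemma edge_class_position k (order : {perm 'I_(2 * k)}) (x y z t : 'I_(2 * k)) :
  YSL_order order -> odd x != odd y -> odd z != odd t ->
  edge_class [set x; y] = edge_class [set z; t] ->
  position order x + position order y
    = position order z + position order t %[mod 2 * k].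
Proof.
case/YSL_position => r pos_mod.
suff pos_sum (u v : 'I_(2 * k)) : odd u != odd v ->
    position order u + position order v
      = edge_class [set u; v] + r %[mod 2 * k].
  by move=> oxy ozt eq_xy; rewrite !pos_sum // eq_xy.
move=> ouv; rewrite /edge_class big_pair_sum ?opp_parity_neq // modnDml.
rewrite -modnDm !pos_mod modnDm addnACA -mulnDl.
(* Exactly one end is even, so the shift [r] enters the sum once, whatever the edge. *)
have -> : ~~ odd u + ~~ odd v = 1 by case: (odd u) (odd v) ouv => [] [].
by rewrite mul1n.
Qed.

Lemma edge_parity k (a : {set 'I_(2 * k)}) (x y : 'I_(2 * k)) :
  a \in edges (circulant (odd_jumps k)) -> x \in a -> y \in a -> x != y ->
  a = [set x; y] /\ odd x != odd y.
Proof.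
case/imsetP => -[u v]; rewrite inE /= circulant_odd_jumps => ouv ->.
rewrite !inE => /orP[] /eqP -> /orP[] /eqP ->; rewrite ?eqxx // => _.
by rewrite setUC eq_sym.
Qed.

(** Both claims follow from equal position sums: a common end cancels and forces the other ends to
    agree, while interleaved chords have different sums. *)
Lemma same_class_page k (order : {perm 'I_(2 * k)}) (a b : {set 'I_(2 * k)}) :
  YSL_order order ->
  a \in edges (circulant (odd_jumps k)) ->
  b \in edges (circulant (odd_jumps k)) ->
  a != b -> edge_class a = edge_class b ->
  [disjoint a & b] /\ ~~ cross order a b.
Proof.
move=> ysl aE bE neq_ab eq_ab.
have sum_pos x y z t : x \in a -> y \in a -> z \in b -> t \in b ->
    x != y -> z != t -> position order x + position order y
      = position order z + position order t %[mod 2 * k].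
  move=> xa ya zb tb xy zt.
  have [ea oxy] := edge_parity aE xa ya xy.
  have [eb ozt] := edge_parity bE zb tb zt.
  by apply: edge_class_position; rewrite -?ea -?eb.
have pos_neq (x y : 'I_(2 * k)) : position order x < position order y -> x != y.
  by apply: contraTneq => ->; rewrite ltnn.
split.
  have other (c : {set 'I_(2 * k)}) x :
      c \in edges (circulant (odd_jumps k)) -> x \in c ->
      exists2 y, y \in c & x != y.
    case/imsetP => -[u v]; rewrite inE /= circulant_odd_jumps.
    move=> /opp_parity_neq uv ->; rewrite !inE => /orP[] /eqP ->.
      by exists v; rewrite ?inE ?eqxx ?orbT.
    by exists u; rewrite ?inE ?eqxx // eq_sym.
  apply/pred0P => x /=; apply/negP => /andP[xa xb].
  have [y ya xy] := other a x aE xa.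
  have [t tb xt] := other b x bE xb.
  move/eqP: (sum_pos x y x t xa ya xb tb xy xt).
  rewrite eqn_modDl !modn_small // => /eqP /val_inj /perm_inj eq_yt.
  have [ea _] := edge_parity aE xa ya xy.
  have [eb _] := edge_parity bE xb tb xt.
  by rewrite ea eb eq_yt eqxx in neq_ab.
apply/negP => /existsP[x /andP[xa /existsP[y /andP[ya]]]].
case/existsP => z /andP[zb /existsP[t /andP[tb]]].
case/orP => /and3P[lt1 lt2 lt3].
  apply: (interleaved_sum_neq lt1 lt2 lt3 (ltn_ord _)).
  by apply: sum_pos => //; apply: pos_neq;
    [apply: ltn_trans lt2 | apply: ltn_trans lt3].
apply: (interleaved_sum_neq lt1 lt2 lt3 (ltn_ord _)).
by symmetry; apply: sum_pos => //; apply: pos_neq;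
  [apply: ltn_trans lt3 | apply: ltn_trans lt2].
Qed.

Theorem theorem2 (k : nat) (hk : 2 <= k)
    (order : {perm 'I_(2 * k)}) (horder : YSL_order order) :
  let C : rel 'I_(2 * k) := @circulant (2 * k) (odd_jumps k) in
  exists c : {set 'I_(2 * k)} -> 'I_(max_degree C),
    page_coloring order C c /\
    (forall t : 'I_(max_degree C),
       exists2 s : nat, s \in odd_jumps k &
         forall i j : 'I_(2 * k), C i j -> c [set i; j] = t -> jump s i j).
Proof.
have k_gt0 : 0 < k by apply: leq_trans hk.
move=> C.
(* Edge classes are odd residues below [2 * k], so halving numbers them injectively from [0] to
   [k - 1]. *)
have color_lt (a : {set 'I_(2 * k)}) : (edge_class a)./2 < max_degree C.
  apply: leq_trans (leq_max_degree k_gt0).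
  by rewrite ltn_half_double -mul2n edge_class_lt.
have edge_odd a : a \in edges C -> odd (edge_class a).
  case/imsetP => -[i j]; rewrite inE /C circulant_odd_jumps => oij ->.
  exact: edge_class_odd.
exists (fun a => Ordinal (color_lt a)); split=> [a b aE bE neq_ab | t].
  move=> /(congr1 val) /= eq_half; apply: same_class_page => //.
  by rewrite -[LHS]odd_double_half -[RHS]odd_double_half eq_half !edge_odd.
(* Colors [t >= k] are unused; reducing modulo [2k] gives them some jump. *)
pose d := t.*2.+1 %% (2 * k).
exists (class_jump k d).
  apply: class_jump_mem; first by rewrite odd_modd /= odd_double.
  by rewrite ltn_mod muln_gt0.
move=> i j; rewrite /C circulant_odd_jumps => oij /(congr1 val) /= eq_t.
have -> : d = edge_class [set i; j]; last exact: jump_edge_class.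
have := odd_double_half (edge_class [set i; j]).
by rewrite /d -eq_t edge_class_odd // add1n => ->;
  rewrite modn_small ?edge_class_lt.
Qed.
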